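(* Let $X_1,\dots,X_n$ and $Y$ be Banach spaces, $X:= X_1\times \cdots \times X_n$, $G \subset X$ an open set and $f:G \to Y$ an arbitrary mapping. Let the spaces $\mathcal{L}(X_1, Y),\dots, \mathcal{L}(X_{n-1}, Y)$ be separable. Then there exists a $\sigma$-porous set $A \subset G$ such that, for all $x \in G \setminus A$, the following implication holds: if $f$ is Lipschitz at $x$ and has all Fréchet partial derivatives $f'_1(x),\dots,f'_n(x)$ at $x$, then $f$ is Fréchet differentiable at $x$.
   Context: All Banach spaces are real and nontrivial ($\neq\{0\}$), with norm denoted $|\cdot|$. $X_1\times\cdots\times X_n$ is equipped with the maximum norm. $\mathcal{L}(X_i,Y)$ is the Banach space of continuous linear mappings $X_i\to Y$ with the operator norm. $B(x,r)$ is the open ball. For $x=(x_1,\dots,x_n)\in G$, the partial Fréchet derivative $f'_i(x)\in\mathcal{L}(X_i,Y)$ is (if it exists) the Fréchet derivative at $x_i$ of the mapping $t\mapsto f(x_1,\dots,x_{i-1},t,x_{i+1},\dots,x_n)$, defined for those $t\in X_i$ for which the argument lies in $G$. $f$ is Lipschitz at $x\in G$ if $\limsup_{y\to x}\frac{|f(y)-f(x)|}{|y-x|}<\infty$. A set $A\subset X$ is porous at $x\in X$ if there exists $c>0$ such that for each $\delta>0$ there exists $t\in B(x,\delta)\setminus\{x\}$ with $B(t,c|t-x|)\cap A=\emptyset$. $A$ is porous if it is porous at each of its points, and $\sigma$-porous if it is a countable union of porous sets. *)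

(* Defs.v *)
From HB Require Import structures.
From mathcomp Require Import all_boot all_order all_algebra.
From mathcomp Require Import all_classical all_reals all_analysis.

Set Implicit Arguments.
Unset Strict Implicit.
Unset Printing Implicit Defensive.

Import Order.TTheory GRing.Theory Num.Theory.
Import numFieldNormedType.Exports.

Local Open Scope classical_set_scope.
Local Open Scope ring_scope.

(* The product X_0 * ... * X_(n-1) with the maximum norm.  A separate constant
   keeps these instances apart from the pointwise ones on plain functions. *)
Definition maxprod (R : realType) (n : nat) (X : 'I_n -> normedModType R) :
  Type := forall i, X i.

Section MaxProd.
Context (R : realType) (n : nat) (X : 'I_n -> normedModType R).
Implicit Types x y z : maxprod X.

HB.instance Definition _ := gen_eqMixin (maxprod X).
HB.instance Definition _ := gen_choiceMixin (maxprod X).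

Definition maxprod_zero : maxprod X := fun=> 0.
Definition maxprod_opp x : maxprod X := fun i => - x i.
Definition maxprod_add x y : maxprod X := fun i => x i + y i.
Definition maxprod_scale (a : R) x : maxprod X := fun i => a *: x i.

Lemma maxprod_addA : associative maxprod_add.
Proof. by move=> x y z; apply: functional_extensionality_dep => i; exact: addrA. Qed.

Lemma maxprod_addC : commutative maxprod_add.
Proof. by move=> x y; apply: functional_extensionality_dep => i; exact: addrC. Qed.

Lemma maxprod_add0 : left_id maxprod_zero maxprod_add.
Proof. by move=> x; apply: functional_extensionality_dep => i; exact: add0r. Qed.

Lemma maxprod_addN : left_inverse maxprod_zero maxprod_opp maxprod_add.
Proof. by move=> x; apply: functional_extensionality_dep => i; exact: addNr. Qed.

HB.instance Definition _ := GRing.isZmodule.Build (maxprod X)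
  maxprod_addA maxprod_addC maxprod_add0 maxprod_addN.

Lemma maxprod_scaleA a b x :
  maxprod_scale a (maxprod_scale b x) = maxprod_scale (a * b) x.
Proof. by apply: functional_extensionality_dep => i; exact: scalerA. Qed.

Lemma maxprod_scale1 : left_id 1 maxprod_scale.
Proof. by move=> x; apply: functional_extensionality_dep => i; exact: scale1r. Qed.

Lemma maxprod_scaleDr : right_distributive maxprod_scale +%R.
Proof.
by move=> a x y; apply: functional_extensionality_dep => i; exact: scalerDr.
Qed.

Lemma maxprod_scaleDl x : {morph maxprod_scale^~ x : a b / a + b}.
Proof.
by move=> a b; apply: functional_extensionality_dep => i; exact: scalerDl.
Qed.

HB.instance Definition _ := GRing.Zmodule_isLmodule.Build R (maxprod X)
  maxprod_scaleA maxprod_scale1 maxprod_scaleDr maxprod_scaleDl.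

Definition maxprod_norm x : R := \big[Num.max/0]_(i < n) `|x i|.

Lemma maxprod_norm_ge0 x : 0 <= maxprod_norm x.
Proof. exact: bigmax_ge_id. Qed.

Lemma le_maxprod_norm x i : `|x i| <= maxprod_norm x.
Proof. exact: (le_bigmax _ (fun j => `|x j|)). Qed.

Lemma maxprod_normD x y :
  maxprod_norm (x + y) <= maxprod_norm x + maxprod_norm y.
Proof.
apply: bigmax_le => [|i _]; first by rewrite addr_ge0 ?maxprod_norm_ge0.
by rewrite (le_trans (ler_normD _ _))// lerD ?le_maxprod_norm.
Qed.

Lemma maxprod_normZ (a : R) x : maxprod_norm (a *: x) = `|a| * maxprod_norm x.
Proof.
rewrite /maxprod_norm; elim/big_ind2 : _ => [|u v u' v' -> ->|i _].
- by rewrite mulr0.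
- by rewrite maxr_pMr.
- exact: normrZ.
Qed.

Lemma maxprod_norm_eq0 x : maxprod_norm x = 0 -> x = 0.
Proof.
move=> x0; apply: functional_extensionality_dep => i; apply/normr0_eq0/le_anti.
by rewrite normr_ge0 andbT -x0 le_maxprod_norm.
Qed.

HB.instance Definition _ := Lmodule_isNormed.Build R (maxprod X)
  maxprod_normD maxprod_normZ maxprod_norm_eq0.

End MaxProd.

Section ContinuousLinear.
Context (R : realType) (V W : normedModType R).

Definition contlin_pred : {pred V -> W} :=
  [pred f | `[< linear f /\ continuous f >]].

Lemma contlin_submod_closed : submod_closed contlin_pred.
Proof.
split=> [|a f g /asboolP[lf cf] /asboolP[lg cg]]; apply/asboolP; split.
- by move=> b u v; rewrite [RHS]addr0 [RHS]scaler0.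
- exact: cst_continuous.
- move=> b u v.
  change (a *: f (b *: u + v) + g (b *: u + v) =
          b *: (a *: f u + g u) + (a *: f v + g v)).
  by rewrite lf lg !scalerDr addrACA !scalerA [a * b]mulrC.
- move=> u; apply: cvgD; last exact: cg.
  by apply: cvgZr; exact: cf.
Qed.

HB.instance Definition _ :=
  GRing.isSubmodClosed.Build R (V -> W) contlin_pred contlin_submod_closed.

(* The space of continuous linear maps from V to W. *)
Record contlin := ContLin {
  contlin_fun :> V -> W;
  contlinP : contlin_fun \in contlin_pred }.

HB.instance Definition _ := [isSub for contlin_fun].
HB.instance Definition _ := [Choice of contlin by <:].
HB.instance Definition _ := [SubChoice_isSubLmodule of contlin by <:].

Definition opnorm (f : contlin) : R :=
  sup [set `|f x| | x in [set x : V | `|x| <= 1]].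

Lemma contlin_linear (f : contlin) : linear f.
Proof. by have /asboolP[] := contlinP f. Qed.

Lemma contlin_continuous (f : contlin) : continuous f.
Proof. by have /asboolP[] := contlinP f. Qed.

HB.instance Definition _ (f : contlin) :=
  GRing.isLinear.Build R V W *:%R f (contlin_linear f).

Lemma opnorm_has_sup (f : contlin) :
  has_sup [set `|f x| | x in [set x : V | `|x| <= 1]].
Proof.
split; first by exists `|f 0|, 0 => //=; rewrite normr0.
have /linear_bounded_continuous/bounded_funP/(_ 1)[M fM] :
  continuous f by exact: contlin_continuous.
by exists M => _ [x x1 <-]; exact: fM.
Qed.

Lemma le_opnorm1 (f : contlin) (x : V) : `|x| <= 1 -> `|f x| <= opnorm f.
Proof. by move=> x1; apply: sup_upper_bound; [exact: opnorm_has_sup|exists x]. Qed.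

Lemma opnorm_le (f : contlin) (M : R) :
  (forall x : V, `|x| <= 1 -> `|f x| <= M) -> opnorm f <= M.
Proof.
move=> fM; apply: ge_sup; first by have [] := opnorm_has_sup f.
by move=> _ [x x1 <-]; exact: fM.
Qed.

Lemma opnorm_ge0 (f : contlin) : 0 <= opnorm f.
Proof. by rewrite (le_trans _ (@le_opnorm1 f 0 _)) ?normr0. Qed.

Lemma le_opnorm (f : contlin) (x : V) : `|f x| <= opnorm f * `|x|.
Proof.
have [->|x0] := eqVneq x 0; first by rewrite linear0 !normr0 mulr0.
have nx0 : 0 < `|x| by rewrite normr_gt0.
have := @le_opnorm1 f (`|x|^-1 *: x).
rewrite linearZ/= !normrZ normfV normr_id mulVf ?gt_eqF// => /(_ (lexx _)).
by rewrite ler_pdivrMl// mulrC.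
Qed.

Lemma opnormD (f g : contlin) : opnorm (f + g) <= opnorm f + opnorm g.
Proof.
apply: opnorm_le => x x1.
by rewrite (le_trans (ler_normD _ _))// lerD ?le_opnorm1.
Qed.

Lemma opnormZ (a : R) (f : contlin) : opnorm (a *: f) = `|a| * opnorm f.
Proof.
have le_opnormZ b g : opnorm (b *: g) <= `|b| * opnorm g.
  apply: opnorm_le => x x1.
  by rewrite [leLHS](normrZ b (g x)) ler_wpM2l ?le_opnorm1.
apply/le_anti; rewrite le_opnormZ/=.
have [->|a0] := eqVneq a 0; first by rewrite normr0 mul0r opnorm_ge0.
by rewrite -ler_pdivlMl ?normr_gt0// -normfV -{1}(scalerK a0 f) le_opnormZ.
Qed.

Lemma opnorm_eq0 (f : contlin) : opnorm f = 0 -> f = 0.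
Proof.
move=> f0; apply/val_inj/funext => x; apply/normr0_eq0/le_anti.
by rewrite normr_ge0 andbT (le_trans (le_opnorm f x))// f0 mul0r.
Qed.

HB.instance Definition _ := Lmodule_isNormed.Build R contlin
  opnormD opnormZ opnorm_eq0.

End ContinuousLinear.

Definition separable (T : topologicalType) : Prop :=
  exists2 D : set T, countable D & dense D.

Section Porous.
Context (R : realType) (V : normedModType R).
Implicit Types A : set V.

Definition porous_at A (x : V) : Prop :=
  exists2 c : R, 0 < c & forall d : R, 0 < d ->
    exists t : V,
      [/\ ball x d t, t != x & ball t (c * `|t - x|) `&` A = set0].

Definition porous A : Prop := forall x, A x -> porous_at A x.

Definition sigma_porous A : Prop :=
  exists2 F : nat -> set V, (forall k, porous (F k)) & A = \bigcup_k F k.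

End Porous.

Definition lipschitz_at (R : realType) (V W : normedModType R) (f : V -> W)
    (x : V) : Prop :=
  (limf_esup (fun y => (`|f y - f x| / `|y - x|)%:E) x^' < +oo)%E.

(* Existence of the i-th partial Frechet derivative; [dfwith x i t] is [x] with
   its i-th coordinate replaced by [t]. *)
Definition partially_differentiable (R : realType) (n : nat)
    (X : 'I_n -> normedModType R) (W : normedModType R) (f : maxprod X -> W)
    (x : maxprod X) (i : 'I_n) : Prop :=
  differentiable (fun t : X i => f (dfwith x i t)) (x i).

(* Main.v *)
(* Split [G] into countably many pieces on which the Lipschitz constant, the
   radii and approximants [S i] (taken from countable dense sets) of the first
   n - 1 partial derivatives are uniform; [A] collects the points at which the
   piece containing them is porous.  If a piece is not porous at [x], then it
   has points very close to every point near [x].  Go from [x] to [x + h] one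
   coordinate at a time, changing the last coordinate first: this first step
   starts at [x] itself, so it only needs the partial derivative at [x], which
   is why no separability is assumed for the last space.  Each other step is
   compared with a partial increment based at a nearby point of the piece. *)

From HB Require Import structures.
Require Import Defs.
From mathcomp Require Import all_boot all_order all_algebra.
From mathcomp Require Import all_classical all_reals all_analysis.
From mathcomp Require Import lra.

Import Order.TTheory GRing.Theory Num.Theory.
Import numFieldNormedType.Exports.

Local Open Scope classical_set_scope.
Local Open Scope ring_scope.

(** * Quantitative differentiability, Lipschitz bounds and porosity at a point *)

Section EpsilonDelta.
Context {R : realType} {V W : normedModType R}.
Implicit Types (f : V -> W) (x y : V).

(** [L] need not be the derivative, and [e] is fixed: an approximant from a dense sequence satisfies
    the estimate only up to its own error. *)
Definition first_order f x (L : V -> W) (e d : R) : Prop :=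
  forall y, `|y - x| < d -> `|f y - f x - L (y - x)| <= e * `|y - x|.

Definition lipschitz_near f x (K d : R) : Prop :=
  forall y, `|y - x| < d -> `|f y - f x| <= K * `|y - x|.

Lemma first_order_diff f x (e : R) : differentiable f x -> 0 < e ->
  exists2 d, 0 < d & first_order f x ('d f x) e d.
Proof.
move=> /diff_locally/eqaddoP fx /fx /nbhs_ballP[d /= d0 fd].
exists d => // y yx.
have := fd (y - x); rewrite /= -ball_normE /= sub0r normrN => /(_ yx).
by rewrite !fctE /= subrK opprD addrA.
Qed.

(** By [diff_unique], the expansion along [L] forces ['d f x] to be [L]. *)
Lemma differentiable_first_order f x (L : {linear V -> W}) : continuous L ->
  (forall e, 0 < e -> exists2 d, 0 < d & first_order f x L e d) ->
  differentiable f x.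
Proof.
move=> cL fL.
have fxL : f \o shift x = cst (f x) + L +o_ 0 id.
  apply/eqaddoP => e /fL[d d0 fd]; apply/nbhs_ballP; exists d => //= h.
  rewrite -ball_normE /= sub0r normrN => hd.
  by have := fd (h + x); rewrite addrK !fctE /= opprD addrA; apply.
have dfE := diff_unique cL fxL.
by apply/diff_locallyP; rewrite dfE.
Qed.

Lemma lipschitz_atP f x : lipschitz_at f x ->
  exists2 K : R, 0 <= K & exists2 d, 0 < d & lipschitz_near f x K d.
Proof.
move=> /ereal_inf_lt[_ [U /nbhs_ballP[d /= d0 dU] <-]] supU.
set g := fun y : V => _ in supU.
have [K K0 gK] : exists2 K : R, 0 <= K & forall y, U y -> (g y <= K%:E)%E.
  have gU y : U y -> (g y <= ereal_sup [set g x | x in U])%E.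
    by move=> Uy; apply: ereal_sup_ubound; exists y.
  move: supU gU; case: (ereal_sup _) => [s _ gU|//|_ gU].
    exists (Num.max s 0); first by rewrite le_max lexx orbT.
    by move=> y /gU /le_trans; apply; rewrite lee_fin le_max lexx.
  (* A supremum [-oo] leaves no point in [U], so any constant works. *)
  by exists 0 => // y /gU; rewrite leeNy_eq.
exists K => //; exists d => // y yx.
have [->|yNx] := eqVneq y x; first by rewrite !subrr !normr0 mulr0.
have := gK y; rewrite /g lee_fin ler_pdivrMr ?normr_gt0 ?subr_eq0//; apply.
by apply: dU => //; rewrite -ball_normE /= distrC.
Qed.

Lemma porous_at_sub (A B : set V) x :
  A `<=` B -> porous_at B x -> porous_at A x.
Proof.
move=> AB [c c0 Bx]; exists c => // d /Bx[t [xt tx tB]].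
by exists t; split => //; rewrite -subset0 => z [tz /AB Bz]; rewrite -tB.
Qed.

(** Porosity fails for every constant, so [c] is free; it will be small relative to a Lipschitz
    constant and an operator norm. *)
Lemma nonporous_at (A : set V) x (c : R) : A x -> ~ porous_at A x -> 0 < c ->
  exists2 d, 0 < d &
    forall t, `|t - x| < d -> exists2 z, A z & `|t - z| <= c * `|t - x|.
Proof.
move=> Ax nA c0; apply: contrapT => nd; apply: nA; exists c => // d d0.
apply: contrapT => nt; apply: nd; exists d => // t td.
have [->|tx] := eqVneq t x; first by exists x; rewrite // !subrr normr0 mulr0.
apply: contrapT => nz; apply: nt; exists t; split => //.
  by rewrite -ball_normE /= distrC.
rewrite -subset0 => z [tz Az]; apply: nz; exists z => //.
by move: tz; rewrite -ball_normE => /ltW.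
Qed.

End EpsilonDelta.

Lemma separable_seq {R : realType} {V : normedModType R} :
  separable V -> exists s : nat -> V,
    forall (v : V) e, 0 < e -> exists m, `|v - s m| < e.
Proof.
move=> [D /pfcard_geP[->|[s]] dD].
  (* A dense set is not empty, since the space contains 0. *)
  by have [z []] := dD setT (ex_intro _ 0 I) openT.
exists s => v e e0.
have [|z [vz Dz]] := dD (ball v e) _ (ball_open _ e).
  by exists v; exact: ballxx.
by have [m _ sm] := 'surj_s Dz; exists m; rewrite sm; move: vz;
  rewrite -ball_normE.
Qed.

(** * Increments in the product space, one coordinate at a time *)

Section Maxprod.
Context {R : realType} {n : nat} {X : 'I_n -> normedModType R}.
Implicit Types (x y z p q : maxprod X).

Lemma maxprod_norm_le x (M : R) :
  0 <= M -> (forall i, `|x i| <= M) -> `|x| <= M.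
Proof. by move=> M0 xM; apply: bigmax_le. Qed.

Lemma norm_coord_le x i : `|x i| <= `|x|.
Proof. exact: le_maxprod_norm. Qed.

Lemma coordB x y i : (x - y) i = x i - y i.
Proof. by []. Qed.

Lemma dfwith_id x i : dfwith x i (x i) = x.
Proof.
by apply: functional_extensionality_dep => j; case: dfwithP.
Qed.

(* [splice x y 0] is [y] and [splice x y n] is [x]. *)
Definition splice x y (k : nat) : maxprod X :=
  fun i => if (k <= i)%N then y i else x i.

Lemma norm_splice_le x y k : `|splice x y k - x| <= `|y - x|.
Proof.
apply: maxprod_norm_le => // i; rewrite coordB /splice.
by case: ifP => _; rewrite ?subrr ?normr0// -coordB norm_coord_le.
Qed.

Context {Y : normedModType R}.
Implicit Types f : maxprod X -> Y.

Definition total_diff (D : forall i, contlin (X i) Y) x : Y :=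
  \sum_i D i (x i).

Lemma total_diff_linear D : linear (total_diff D).
Proof.
move=> a x y; rewrite /total_diff scaler_sumr -big_split /=.
by apply: eq_bigr => i _; rewrite -linearP.
Qed.

HB.instance Definition _ D :=
  GRing.isLinear.Build R (maxprod X) Y *:%R (total_diff D)
    (total_diff_linear D).

Lemma total_diff_continuous D : continuous (total_diff D).
Proof.
apply/linear_bounded_continuous/bounded_funP => r.
exists (\sum_i opnorm (D i) * r) => x xr.
apply: le_trans (ler_norm_sum _ _ _) _; apply: ler_sum => i _.
apply: le_trans (le_opnorm _ _) _.
by rewrite ler_wpM2l ?opnorm_ge0// (le_trans (norm_coord_le x i)).
Qed.

(** Successive splices reset one coordinate from [y] to [x], so the increments of [f] telescope, and
    [total_diff D] splits into matching summands. *)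
Lemma telescoping_bound f x y (D : forall i, contlin (X i) Y) (e : R) :
  (forall k : 'I_n, `|f (splice x y k) - f (splice x y k.+1)
                      - D k (y k - x k)| <= e) ->
  `|f y - f x - total_diff D (y - x)| <= n%:R * e.
Proof.
move=> fD.
have -> : f y - f x =
    \sum_(k < n) (f (splice x y k) - f (splice x y k.+1)).
  rewrite -(big_mkord xpredT
    (fun k => f (splice x y k) - f (splice x y k.+1))).
  under eq_bigr do rewrite -opprB.
  rewrite sumrN telescope_sumr// opprB; congr (f _ - f _).
  apply: functional_extensionality_dep => i.
  by rewrite /splice leqNgt ltn_ord.
rewrite /total_diff -sumrB; apply: le_trans (ler_norm_sum _ _ _) _.
apply: le_trans (ler_sum _ (fun i _ => fD i)) _.
by rewrite sumr_const card_ord mulr_natl.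
Qed.

(* Since [A] is not porous at [x], it has points [z] and [w] very close to [p]
   and [q].  Moving from [z] in direction [k] one reaches a point close to [w],
   and the partial increment is controlled at [z] while all the other
   displacements are controlled by the Lipschitz property at [z] and [w]. *)
Lemma nonporous_partial_increment f (A : set (maxprod X)) x k
    (S : contlin (X k) Y) (K e r : R) :
  0 <= K -> 0 < e -> 0 < r ->
  (forall z, A z -> lipschitz_near f z K r /\
     first_order (fun t => f (dfwith z k t)) (z k) S e r) ->
  A x -> ~ porous_at A x ->
  exists2 d, 0 < d & forall p q, `|p - x| < d -> `|q - x| <= `|p - x| ->
    (forall i, i != k -> q i = p i) ->
    `|f p - f q - S (p k - q k)| <= 5 * e * `|p - x|.
Proof.
move=> K0 e0 r0 hA Ax nA; set M := opnorm S.
have M0 : 0 <= M := opnorm_ge0 S.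
have C0 : 0 < 4 * K + 2 * M + 1 by lra.
(* Relative to [rho], the Lipschitz errors below add up to [4 * K * c] and the change of argument in
   [S] costs [2 * M * c]; this [c] makes the total at most [e]. *)
pose c := Num.min 1 (e / (4 * K + 2 * M + 1)).
have c0 : 0 < c by rewrite lt_min ltr01 divr_gt0.
have c1 : c <= 1 by rewrite ge_min lexx.
have cC : 4 * (K * c) + 2 * (M * c) <= e.
  have : c <= e / (4 * K + 2 * M + 1) by rewrite ge_min lexx orbT.
  rewrite ler_pdivlMr//; nra.
have [d d0 dA] := nonporous_at _ _ _ Ax nA c0.
(* All displacements from [z] and [w] below are at most [4 * rho], hence smaller than [r]. *)
exists (Num.min d (r / 4)) => [|p q]; first by rewrite lt_min d0 divr_gt0.
rewrite lt_min => /andP[pd pr] qp qpk; set rho := `|p - x| in pr qp *.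
have rho0 : 0 <= rho by exact: normr_ge0.
have [w Aw pw] := dA p pd.
have [z Az qz'] := dA q (le_lt_trans qp pd).
have qz : `|q - z| <= c * rho by rewrite (le_trans qz')// ler_wpM2l// ltW.
have crho : c * rho <= rho by rewrite ler_piMl.
have {}pw : `|p - w| <= c * rho := pw.
have [Lw _] := hA _ Aw.
have [Lz Dz] := hA _ Az.
(* Off coordinate [k] the points [p] and [q] agree, so [z] and [w] are close there, and [z'] is
   close to [w]. *)
pose z' : maxprod X := dfwith z k (w k).
have pq : `|p k - q k| <= 2 * rho.
  rewrite -coordB (le_trans (norm_coord_le _ _))//.
  have -> : p - q = (p - x) - (q - x) by rewrite opprB addrA subrK.
  by rewrite (le_trans (ler_normB _ _))// -/rho; lra.
have wzpq : `|w k - z k - (p k - q k)| <= 2 * (c * rho).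
  have -> : w k - z k - (p k - q k) = (q - z) k - (p - w) k.
    by rewrite !coordB !opprB [LHS]addrACA [RHS]addrACA [w k + _]addrC.
  rewrite (le_trans (ler_normB _ _))//.
  by have := norm_coord_le (q - z) k; have := norm_coord_le (p - w) k; lra.
have wz : `|w k - z k| <= 4 * rho.
  rewrite -(subrK (p k - q k) (w k - z k)) (le_trans (ler_normD _ _))//; lra.
have z'w : `|z' - w| <= 2 * (c * rho).
  apply: maxprod_norm_le => [|i]; first by rewrite !mulr_ge0// ltW.
  rewrite coordB /z'; case: dfwithP => [|i' ki].
    by rewrite subrr normr0 !mulr_ge0// ltW.
  have -> : z i' - w i' = (p - w) i' - (q - z) i'.
    by rewrite !coordB qpk 1?eq_sym// opprB [RHS]addrC addrA subrK.
  rewrite (le_trans (ler_normB _ _))//.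
  by have := norm_coord_le (q - z) i'; have := norm_coord_le (p - w) i'; lra.
have b1 : `|f p - f w| <= K * (c * rho).
  by rewrite (le_trans (Lw _ _)) ?ler_wpM2l//; lra.
have b2 : `|f z' - f w| <= K * (2 * (c * rho)).
  by rewrite (le_trans (Lw _ _)) ?ler_wpM2l//; lra.
have b3 : `|f z' - f z - S (w k - z k)| <= e * (4 * rho).
  have := Dz (w k); rewrite dfwith_id => /(_ _)/le_trans -> //; first lra.
  by rewrite ler_wpM2l// ltW.
have b4 : `|f q - f z| <= K * (c * rho).
  by rewrite (le_trans (Lz _ _)) ?ler_wpM2l//; lra.
have b5 : `|S (w k - z k - (p k - q k))| <= M * (2 * (c * rho)).
  by rewrite (le_trans (le_opnorm _ _))// ler_wpM2l.
(* The path is [p], [w], [z'], [z], [q]. The leg between [z'] and [z] contributes [4 * e * rho], all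
   other terms together [e * rho]. *)
have -> : f p - f q - S (p k - q k) = (f p - f w) - (f z' - f w)
    + (f z' - f z - S (w k - z k)) - (f q - f z)
    + S (w k - z k - (p k - q k)).
  rewrite (linearB S (w k - z k)).
  rewrite !opprB subrKA -(addrA (f z')) subrKA (addrA (f p)).
  by rewrite [f p - f z - _ + _]addrAC !subrKA.
apply: le_trans (ler_normD _ _) _.
have := ler_normB
  (f p - f w - (f z' - f w) + (f z' - f z - S (w k - z k))) (f q - f z).
have := ler_normD (f p - f w - (f z' - f w)) (f z' - f z - S (w k - z k)).
have := ler_normB (f p - f w) (f z' - f w).
have : (4 * (K * c) + 2 * (M * c)) * rho <= e * rho by rewrite ler_wpM2r.
nra.
Qed.

End Maxprod.

(** * Pieces with uniform constants *)

Section Pieces.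
Context {R : realType} {n : nat} {X : 'I_n -> normedModType R}.
Context {Y : normedModType R}.

Definition piece (G : set (maxprod X)) (f : maxprod X -> Y)
    (S : forall i, contlin (X i) Y) (K e r : R) : set (maxprod X) :=
  [set z | [/\ G z, lipschitz_near f z K r & forall i : 'I_n, (i.+1 < n)%N ->
    first_order (fun t => f (dfwith z i t)) (z i) (S i) e r]].

(** In each of the [n] coordinate steps, [5 * e] comes from the partial increment and one more [e]
    from replacing [S] by [D]. *)
Lemma nonporous_piece_first_order G f S (K e r : R) x
    (D : forall i, contlin (X i) Y) :
  0 <= K -> 0 < e -> 0 < r -> piece G f S K e r x ->
  ~ porous_at (piece G f S K e r) x ->
  (forall i : 'I_n, (i.+1 < n)%N -> `|D i - S i| <= e) ->
  (forall i, exists2 d, 0 < d &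
    first_order (fun t => f (dfwith x i t)) (x i) (D i) e d) ->
  exists2 d, 0 < d & first_order f x (total_diff D) (n%:R * (6 * e)) d.
Proof.
move=> K0 e0 r0 Px nP DS Dx.
have step (k : 'I_n) : exists d : R, 0 < d /\ forall y, `|y - x| < d ->
    `|f (splice x y k) - f (splice x y k.+1) - D k (y k - x k)|
      <= 6 * e * `|y - x|.
  (* For the last index, [splice x y k.+1] is [x] itself, so the derivative at [x] suffices. *)
  have [kn|kn] := ltnP k.+1 n; last first.
    have [d d0 fd] := Dx k; exists d; split=> // y yx.
    have -> : splice x y k.+1 = x.
      apply: functional_extensionality_dep => i; rewrite /splice.
      by rewrite leqNgt (leq_trans (ltn_ord i) kn).
    have -> : splice x y k = dfwith x k (y k).
      apply: functional_extensionality_dep => i; rewrite /splice.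
      case: dfwithP => [|j kj]; first by rewrite leqnn.
      rewrite leq_eqVlt (inj_eq val_inj) (negPf kj)/= ltnNge.
      by rewrite -ltnS (leq_trans (ltn_ord j) kn).
    have ykx : `|y k - x k| <= `|y - x| by rewrite -coordB norm_coord_le.
    have := fd (y k) (le_lt_trans ykx yx).
    rewrite dfwith_id => /le_trans; apply.
    by have := normr_ge0 (y - x); nra.
  have hP z : piece G f S K e r z -> lipschitz_near f z K r /\
      first_order (fun t => f (dfwith z k t)) (z k) (S k) e r.
    by move=> [_ Lz Dz]; split => //; exact: Dz.
  have [d d0 dP] := nonporous_partial_increment f _ x k (S k) K e r
    K0 e0 r0 hP Px nP.
  exists d; split=> // y yx.
  have kx : `|y k - x k| <= `|y - x| by rewrite -coordB norm_coord_le.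
  set p := splice x y k; set q := splice x y k.+1.
  have px : `|p - x| <= `|y - x| by exact: norm_splice_le.
  have qp : `|q - x| <= `|p - x|.
    apply: maxprod_norm_le => // i; rewrite /q coordB /splice.
    case: ifP => [ki|_]; last by rewrite subrr normr0.
    apply: le_trans (norm_coord_le _ i); rewrite coordB /p /splice.
    by rewrite (ltnW ki).
  have qpk i : i != k -> q i = p i.
    move=> ik; rewrite /q /p /splice [(k <= i)%N]leq_eqVlt.
    by rewrite (inj_eq val_inj) eq_sym (negPf ik).
  have := dP p q (le_lt_trans px yx) qp qpk.
  rewrite {2}/p {2}/q /splice leqnn ltnn => pqS.
  have DSk : `|(D k - S k) (y k - x k)| <= e * `|y - x|.
    apply: le_trans (le_opnorm _ _) _.
    by apply: ler_pM => //; [exact: opnorm_ge0 | exact: DS].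
  have -> : f p - f q - D k (y k - x k) =
      (f p - f q - S k (y k - x k)) - (D k - S k) (y k - x k).
    rewrite -[(D k - S k) _]/(D k (y k - x k) - S k (y k - x k)).
    by rewrite opprB addrA subrK.
  apply: le_trans (ler_normB _ _) _.
  have : 5 * e * `|p - x| <= 5 * e * `|y - x| by rewrite ler_wpM2l//; lra.
  lra.
have [d hd] := choice step.
exists (\big[Num.min/1]_i d i).
  by apply: lt_bigmin => [|i _]; [exact: ltr01 | have [] := hd i].
move=> y /bigmin_gtP[_ yx]; rewrite -mulrA; apply: telescoping_bound => k.
by have [_] := hd k; apply; exact: yx.
Qed.

Lemma piece_le G f S (K K' e r r' : R) :
  K <= K' -> r' <= r -> piece G f S K e r `<=` piece G f S K' e r'.
Proof.
move=> KK rr z [Gz Lz Dz]; split=> // [y yz|i ik y yz].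
  by rewrite (le_trans (Lz _ (lt_le_trans yz rr)))// ler_wpM2r.
exact/Dz/(lt_le_trans yz).
Qed.

(** One half of [e] pays for the error of [D], the other for replacing [D] by [S]. The Lipschitz
    constant is then rounded up and the radius down to countably many values. *)
Lemma in_piece (G : set (maxprod X)) (f : maxprod X -> Y) (x : maxprod X)
    (S D : forall i, contlin (X i) Y) (e : R) :
  G x -> lipschitz_at f x ->
  (forall i : 'I_n, (i.+1 < n)%N -> `|D i - S i| <= e / 2) ->
  (forall i, exists2 d, 0 < d &
    first_order (fun t => f (dfwith x i t)) (x i) (D i) (e / 2) d) ->
  exists K r : nat, piece G f S K%:R e r.+1%:R^-1 x.
Proof.
move=> Gx /lipschitz_atP[K K0 [d d0 Ld]] DS Dx.
have /choice[b hb] : forall i, exists d : R, 0 < d /\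
    first_order (fun t => f (dfwith x i t)) (x i) (D i) (e / 2) d.
  by move=> i; have [d' d'0 Dd'] := Dx i; exists d'.
(* The default [d] includes the Lipschitz radius in the minimum. *)
pose r := \big[Num.min/d]_i b i.
have r0 : 0 < r by apply: lt_bigmin => // i _; have [] := hb i.
have xP : piece G f S K e r x.
  split=> // [y yx|i ik y yx].
    by apply: Ld; apply: lt_le_trans yx _; exact: bigmin_le_id.
  have [_ Di] := hb i.
  have /Di {}Di : `|y - x i| < b i.
    by apply: lt_le_trans yx _; exact: bigmin_le.
  have DSy : `|(D i - S i) (y - x i)| <= e / 2 * `|y - x i|.
    apply: le_trans (le_opnorm _ _) _.
    by rewrite ler_wpM2r//; exact: DS.
  rewrite -[_ - _ - S i _](subrKA (D i (y - x i))).
  apply: le_trans (ler_normD _ _) _.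
  rewrite [leRHS](_ : _ = e / 2 * `|y - x i| + e / 2 * `|y - x i|).
    exact: lerD.
  by rewrite -mulrDl -splitr.
exists (Num.truncn K).+1, (Num.truncn r^-1); apply: piece_le xP.
  by rewrite ltW// truncnS_gt.
by rewrite -[leRHS]invrK lef_pV2 ?posrE ?invr_gt0// ltW// truncnS_gt.
Qed.

End Pieces.

Theorem theorem5p2 (R : realType) (n : nat) (n_gt0 : (0 < n)%N)
    (X : 'I_n -> completeNormedModType R) (Y : completeNormedModType R)
    (X_neq0 : forall i, exists v : X i, v != 0)
    (Y_neq0 : exists v : Y, v != 0)
    (G : set (maxprod X)) (G_open : open G) (f : maxprod X -> Y)
    (L_sep : forall i : 'I_n, (i.+1 < n)%N -> separable (contlin (X i) Y)) :
  exists A : set (maxprod X),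
    [/\ sigma_porous A, A `<=` G &
      forall x, (G `\` A) x ->
        lipschitz_at f x -> (forall i, partially_differentiable f x i) ->
        differentiable f x].
Proof.
have s_ex (i : 'I_n) : exists s : nat -> contlin (X i) Y, (i.+1 < n)%N ->
    forall (v : contlin (X i) Y) (e : R), 0 < e -> exists m, `|v - s m| < e.
  (* The last index gets a dummy sequence. *)
  have [ik|ik] := ltnP i.+1 n; last by exists (fun=> 0).
  by have [s hs] := separable_seq (L_sep i ik); exists s => _.
pose s i := projT1 (cid (s_ex i)).
have hs (i : 'I_n) := projT2 (cid (s_ex i)) : (i.+1 < n)%N ->
  forall (v : contlin (X i) Y) (e : R), 0 < e -> exists m, `|v - s i m| < e.
(* The index [a] holds the approximants, the Lipschitz constant, the accuracy and the radius; using
   a finite function makes its type countable. *)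
pose P (a : {ffun 'I_n -> nat} * (nat * nat * nat)) : set (maxprod X) :=
  piece G f (fun i => s i (a.1 i)) a.2.1.1%:R a.2.1.2.+1%:R^-1 a.2.2.+1%:R^-1.
pose F k := if unpickle k is Some a then P a `&` porous_at (P a) else set0.
exists (\bigcup_k F k); split.
- exists F => // k x; rewrite /F; case: unpickle => [a [Px]|//].
  (* Porosity at a point passes from [P a] to its subset [F k]. *)
  by apply: porous_at_sub => y [].
- by move=> x [k _]; rewrite /F; case: unpickle => [a [[]]|].
move=> x [Gx nAx] Lx dfx.
have notporous a : P a x -> ~ porous_at (P a) x.
  by move=> Pa pPa; apply: nAx; exists (pickle a) => //; rewrite /F pickleK.
have cD i : ('d (fun t : X i => f (dfwith x i t)) (x i) : X i -> Y) \in
    @contlin_pred R (X i) Y.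
  apply/asboolP; split; first exact: linearP.
  exact: diff_continuous (dfx i).
pose D i := ContLin (cD i).
apply: (differentiable_first_order _ _ (total_diff D)) => [|e0 e0_gt0].
  exact: total_diff_continuous.
(* The accuracy must be of the form [m.+1%:R^-1] to index a piece; this [m] gives
   [n%:R * (6 * e) <= e0]. *)
pose m := Num.truncn (n%:R * 6 / e0).
set e : R := m.+1%:R^-1.
have e_gt0 : 0 < e by rewrite invr_gt0.
have e2_gt0 : 0 < e / 2 by rewrite divr_gt0.
have he : n%:R * (6 * e) <= e0.
  by rewrite mulrA ler_pdivrMr// [leRHS]mulrC -ler_pdivrMr// ltW// truncnS_gt.
have [sigma hsigma] : exists sigma : {ffun 'I_n -> nat},
    forall i : 'I_n, (i.+1 < n)%N -> `|D i - s i (sigma i)| <= e / 2.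
  suff /choice[g hg] : forall i : 'I_n, exists j : nat,
      (i.+1 < n)%N -> `|D i - s i j| <= e / 2.
    by exists [ffun i => g i] => i; rewrite ffunE; exact: hg.
  move=> i; have [ik|ik] := ltnP i.+1 n; last by exists 0%N.
  by have [j /ltW] := hs i ik (D i) _ e2_gt0; exists j.
have Dx (e' : R) : 0 < e' -> forall i, exists2 d, 0 < d &
    first_order (fun t => f (dfwith x i t)) (x i) (D i) e' d.
  by move=> e'0 i; exact: first_order_diff (dfx i) e'0.
have [K [r Kr]] := in_piece G f x (fun i => s i (sigma i)) D e Gx Lx hsigma
  (Dx _ e2_gt0).
have Px : P (sigma, (K, m, r)) x by [].
have DS (i : 'I_n) : (i.+1 < n)%N -> `|D i - s i (sigma i)| <= e.
  by move=> /hsigma/le_trans; apply; rewrite ler_pdivrMr// ler_peMr ?ltW//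
    ltr1n.
have [|d d0 fd] := nonporous_piece_first_order _ _ _ _ _ _ x D (ler0n _ _)
  e_gt0 _ Px (notporous _ Px) DS (Dx e e_gt0).
  by rewrite invr_gt0.
exists d => // y /fd /le_trans; apply.
by rewrite ler_wpM2r.
Qed.
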